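(* Let $K$ be a field of prime characteristic $p>0$ and let $L/K$ be a finite field extension which is the compositum $L=L_1\cdots L_\nu$ of simple field extensions $L_i=K(\theta_i)\simeq K[x]/(f_i)$, $i=1,\ldots,\nu$, where $f_i(x)=f_i^{sep}(x^{p^{n_i}})=\sum_{j=0}^{s_i}\lambda_{ij}x^{jp^{n_i}}\in K[x]$ is the monic irreducible minimal polynomial of $\theta_i$ over $K$, written in its separable presentation, and $\deg(f_i)=s_ip^{n_i}$. Then the following statements are equivalent: 1. $L=L^{pi}L^{sep}$. 2. $\lambda_{ij}^{1/p^{n_i}}\in L^{pi}$ for all $i=1,\ldots,\nu$ and $j=0,1,\ldots,s_i-1$. 3. $L^{pi}=K\big(\lambda_{ij}^{1/p^{n_i}}\mid i=1,\ldots,\nu;\ j=0,1,\ldots,s_i-1\big)$. 4. $L^{pi}\supseteq K\big(\lambda_{ij}^{1/p^{n_i}}\mid i=1,\ldots,\nu;\ j=0,1,\ldots,s_i-1\big)$.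
   Context: Fix an algebraic closure $\overline{K}$ of $K$ containing all fields considered; composita are taken in $\overline{K}$. For $\lambda\in\overline{K}$ and $k\ge 0$, $\lambda^{1/p^k}$ denotes the unique $p^k$-th root of $\lambda$ in $\overline{K}$. $L^{sep}$ and $L^{pi}$ are the maximal separable and the maximal purely inseparable subextensions of $L/K$. Separable presentation: every non-scalar $f\in K[x]$ considered is written uniquely as $f(x)=f^{sep}(x^{p^n})$ with $f^{sep}\in K[x]$ a separable polynomial and $n\ge 0$. Here $f_i^{sep}(x)=\sum_{j=0}^{s_i}\lambda_{ij}x^j$ with $\lambda_{i s_i}=1$. *)

(* Defs.v *)
From HB Require Import structures.
From mathcomp Require Import all_boot all_order all_algebra all_field.
From mathcomp Require Import boolp classical_sets.

Set Implicit Arguments.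
Unset Strict Implicit.
Unset Printing Implicit Defensive.

Import GRing.Theory.

Local Open Scope classical_set_scope.
Local Open Scope ring_scope.

(* In a field of characteristic p this is a^(1/p^k), the unique r such that  *)
(* r^(p^k) = a; see pkrootK and pkroot_unique.                               *)
Definition pkroot (F : closedFieldType) (p k : nat) (a : F) : F :=
  xget 0 [set r : F | r ^+ (p ^ k) = a].

Lemma pkrootK (F : closedFieldType) (p k : nat) (a : F) :
  p \in [pchar F] -> pkroot p k a ^+ (p ^ k) = a.
Proof.
move=> pF; have p_gt0 : (0 < p ^ k)%N.
  by rewrite expn_gt0 prime_gt0 //; case/andP: pF.
rewrite /pkroot; apply: (@xgetPex _ 0 [set r : F | r ^+ (p ^ k) = a]).
have [|r] := @closed_rootP F ('X^(p ^ k) - a%:P) _.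
  by rewrite size_XnsubC // eqSS -lt0n.
by rewrite /root !hornerE /= subr_eq0 => /eqP ra; exists r.
Qed.

Lemma pkroot_unique (F : closedFieldType) (p k : nat) (a r : F) :
  p \in [pchar F] -> r ^+ (p ^ k) = a -> r = pkroot p k a.
Proof.
move=> pF ra; apply/eqP; rewrite -subr_eq0.
have pN : [pchar F].-nat (p ^ k)%N.
  by rewrite pnatX pnatE ?pF //; case/andP: pF.
have := exprDn_pchar (r - pkroot p k a) (pkroot p k a) pN.
rewrite subrK ra pkrootK // -[LHS]add0r => /addIr/esym/eqP.
by rewrite expf_eq0 => /andP[].
Qed.

Definition subfield_set (F : fieldType) (E : set F) : Prop :=
  [/\ E 1, forall x y, E x -> E y -> E (x - y)
     & forall x y, E x -> E y -> E (x / y)].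

Definition subfield_gen (F : fieldType) (S : set F) : set F :=
  smallest (@subfield_set F) S.

Definition compositum (F : fieldType) (E1 E2 : set F) : set F :=
  subfield_gen (E1 `|` E2).

Definition big_compositum (F : fieldType) (I : Type) (E : I -> set F) : set F :=
  subfield_gen (\bigcup_i E i).

(* K is viewed inside Om through iota, and the intermediate fields between   *)
(* K and Om are subsets of Om.                                               *)
Section Extensions.

Variables (K Om : fieldType) (iota : {rmorphism K -> Om}).

Definition adjoin (S : set Om) : set Om := subfield_gen (range iota `|` S).

Definition is_minpoly (x : Om) (f : {poly K}) : Prop :=
  [/\ f \is monic, irreducible_poly f & root (map_poly iota f) x].

Definition separable_ext (E : set Om) : Prop :=
  forall x, E x -> exists2 f : {poly K}, is_minpoly x f & separable_poly f.

Definition purely_inseparable_ext (p : nat) (E : set Om) : Prop :=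
  forall x, E x -> exists k : nat, range iota (x ^+ (p ^ k)).

Definition subextension (L E : set Om) : Prop :=
  [/\ subfield_set E, range iota `<=` E & E `<=` L].

(* The maximal subextension of L/K with property P, as the compositum of all *)
(* the subextensions with property P.                                        *)
Definition maximal_subext (P : set Om -> Prop) (L : set Om) : set Om :=
  subfield_gen (\bigcup_(E in [set E | subextension L E /\ P E]) E).

Definition Lsep (L : set Om) : set Om := maximal_subext separable_ext L.

Definition Lpi (p : nat) (L : set Om) : set Om :=
  maximal_subext (purely_inseparable_ext p) L.

End Extensions.

(* Main.v *)
(* Put [q = p ^ n_i] and [g_i = \sum_j lambda_ij^(1/q) x^j]; then              *)
(* [f_i = g_i ^ q] and [g_i] is separable with root [theta_i].  If             *)
(* [L = Lpi Lsep], then [theta_i] is separable over [Lpi] and [g_i] is its     *)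
(* minimal polynomial there, so that its coefficients lie in [Lpi].            *)
(* Conversely, [theta_i] is separable over any subfield containing the         *)
(* coefficients of [g_i], while [theta_i ^ q] is separable over [K]; an        *)
(* element which is both separable and purely inseparable over a subfield      *)
(* belongs to it.  Applied over [K_roots] this gives that [Lpi] is contained   *)
(* in [K_roots]; applied over [Lpi Lsep] it gives [L = Lpi Lsep].              *)

Require Import Defs.
From HB Require Import structures.
From mathcomp Require Import all_boot all_order all_algebra all_field.
From mathcomp Require Import boolp classical_sets.

Set Implicit Arguments.
Unset Strict Implicit.
Unset Printing Implicit Defensive.

Import GRing.Theory.

Local Open Scope classical_set_scope.
Local Open Scope ring_scope.

(** Two facts carry the proof. By [separable_over_pi], an element that is separable over a subfield
    and has a [p]-power in it lies in it. By [separable_over_pi_coef], if [theta_i] is separable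
    over a purely inseparable extension of [K], then [g_i], a root of [f_i] of order [p ^ n_i], has
    its coefficients there. If [L = Lpi Lsep], then [L] is separable over [Lpi], because the
    separable elements form a field ([separable_over_subfield]); the second fact then gives
    statement 2. Conversely, [theta_i] is separable over any field containing the coefficients of
    [g_i]. Over [K_roots] this makes all of [L] separable, and the first fact puts [Lpi] inside
    [K_roots]. Over [Lpi Lsep] the first fact applies to [theta_i], whose power is a root of
    [fsep i] and hence lies in [Lsep]. *)

(** * Subfields as sets and as field types *)

Section SubfieldType.

Variables (Om : fieldType) (E : set Om) (subE : subfield_set E).

Definition subfield_pred : pred Om := fun x => `[< E x >].

Lemma subfield_pred_divring_closed : divring_closed subfield_pred.
Proof.
case: subE => E1 EB Ediv; split=> [|x y|x y]; first exact/asboolP.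
  by move=> /asboolP Ex /asboolP Ey; apply/asboolP/EB.
by move=> /asboolP Ex /asboolP Ey; apply/asboolP/Ediv.
Qed.

HB.instance Definition _ :=
  GRing.isDivringClosed.Build Om subfield_pred subfield_pred_divring_closed.

Record subfield_type := SubfieldElt
  { subfield_val :> Om; _ : subfield_val \in subfield_pred }.

HB.instance Definition _ := [isSub for subfield_val].
HB.instance Definition _ := [Choice of subfield_type by <:].
HB.instance Definition _ :=
  [SubChoice_isSubIntegralDomain of subfield_type by <:].
HB.instance Definition _ :=
  [SubIntegralDomain_isSubField of subfield_type by <:].

(** Passage from intermediate fields, which are sets, to field types, over which polynomials and
    field extensions are available. *)
Lemma subfield_set_range :
  exists (F : fieldType) (i : {rmorphism F -> Om}), E = range i.
Proof.
exists subfield_type, (GRing.RMorphism.clone _ _ (val : subfield_type -> Om) _).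
apply/seteqP; split=> [x Ex | _ [u _ <-]]; last exact/asboolP/(valP u).
by have ux : x \in subfield_pred by [apply/asboolP]; exists (SubfieldElt ux).
Qed.

End SubfieldType.

Section SubfieldGen.

Variable F : fieldType.
Implicit Types E S : set F.

Lemma subfield_set0 E : subfield_set E -> E 0.
Proof. by case=> E1 EB _; rewrite -(subrr 1); apply: EB. Qed.

Lemma subfield_setX E x k : subfield_set E -> E x -> E (x ^+ k).
Proof.
move=> subE Ex; case: (subE) => E1 EB Ediv.
elim: k => [|k IHk]; first by rewrite expr0.
rewrite exprSr -[x in _ * x]invrK; apply: (Ediv) => //.
by rewrite -[_^-1]mul1r; apply: Ediv.
Qed.

Lemma subfield_gen_subfield S : subfield_set (subfield_gen S).
Proof.
split=> [E [[E1 _ _] _] //|x y Sx Sy E|x y Sx Sy E] [subE SE].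
  by case: (subE) => _ + _; apply; [apply: Sx | apply: Sy].
by case: (subE) => _ _; apply; [apply: Sx | apply: Sy].
Qed.

Lemma subfield_gen_sub S E :
  subfield_set E -> S `<=` E -> subfield_gen S `<=` E.
Proof. exact: smallest_sub. Qed.

Lemma sub_subfield_gen S : S `<=` subfield_gen S.
Proof. exact: sub_gen_smallest. Qed.

End SubfieldGen.

Lemma range_subfield (F Om : fieldType) (i : {rmorphism F -> Om}) :
  subfield_set (range i).
Proof.
split=> [|_ _ [u _ <-] [v _ <-]|_ _ [u _ <-] [v _ <-]].
- by exists 1; rewrite ?rmorph1.
- by exists (u - v); rewrite ?rmorphB.
- by exists (u / v); rewrite ?fmorph_div.
Qed.

Lemma poly_coef_range (F Om : fieldType) (i : {rmorphism F -> Om})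
    (q : {poly Om}) :
  (forall j, range i q`_j) -> exists r : {poly F}, q = map_poly i r.
Proof.
move=> qE; exists (\poly_(j < size q) xget 0 [set a | i a = q`_j]).
apply/polyP=> j; rewrite coef_map coef_poly.
have [_|szq] := ltnP j (size q); last first.
  by rewrite nth_default //; apply/esym/rmorph0.
case: (qE j) => a _ ia.
by apply/esym/(@xgetPex _ 0 [set a | i a = q`_j]); exists a.
Qed.

(** * Minimal polynomials and finite extensions inside the big field *)

Section OneExtension.

Variables (F Om : fieldType) (i : {rmorphism F -> Om}).

Lemma minpoly_exists x (q : {poly F}) :
  q != 0 -> root (map_poly i q) x -> exists f, is_minpoly i x f.
Proof.
move=> nz_q qx.
have [|m /asboolP[r [nz_r rx ->]] min_r] := @ex_minnP (fun m =>
    `[< exists r : {poly F},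
        [/\ r != 0, root (map_poly i r) x & m = size r] >]).
  by exists (size q); apply/asboolP; exists q.
have nz_lc : (lead_coef r)^-1 != 0 by rewrite invr_eq0 lead_coef_eq0.
exists ((lead_coef r)^-1 *: r); split.
- by rewrite monicE lead_coefZ mulVf // lead_coef_eq0.
- apply/(@subfx_irreducibleP _ _ i x); rewrite ?map_polyZ ?rootZ ?fmorph_eq0 //.
    by rewrite scaler_eq0 negb_or nz_lc.
  move=> s sx nz_s; rewrite size_scale //.
  by apply: min_r; apply/asboolP; exists s.
- by rewrite map_polyZ rootZ ?fmorph_eq0.
Qed.

(** The gcd of [f] and [q] still vanishes at [x], so it is not constant, and irreducibility makes it
    associate to [f]. *)
Lemma minpoly_dvdp x (f q : {poly F}) :
  is_minpoly i x f -> root (map_poly i q) x -> f %| q.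
Proof.
case=> _ irr_f fx qx; have [->|nz_q] := eqVneq q 0; first exact: dvdp0.
have nz_g : gcdp f q != 0 by rewrite gcdp_eq0 (negPf nz_q) andbF.
have /eqp_dvdl <- : gcdp f q %= f; last exact: dvdp_gcdr.
apply: irr_f (dvdp_gcdl _ _).
rewrite -(size_map_poly i) gtn_eqF // (@root_size_gt1 _ x) ?map_poly_eq0 //.
by rewrite gcdp_map root_gcd fx.
Qed.

Lemma simple_fieldExt x (q : {poly F}) :
    q != 0 -> root (map_poly i q) x ->
  exists (M : fieldExtType F) (j : {rmorphism M -> Om}),
    (forall a, j a%:A = i a) /\ range j x.
Proof.
move=> nz_q qx; have [f [_ irr_f fx]] := minpoly_exists nz_q qx.
have nz_f := irredp_neq0 irr_f.
exists (SubFieldExtType fx irr_f), (@subfx_inj _ _ i x f); split.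
  exact: subfx_inj_base.
by exists (subfx_root i x f) => //; apply: subfx_inj_root.
Qed.

End OneExtension.

(** Adjoin [x], then [y] over the result, and view the tower as one finite extension of [F]. The
    theory of separable elements of a finite extension then applies to [x] and [y] together. *)
Lemma double_fieldExt (F Om : fieldType) (i : {rmorphism F -> Om}) x y
    (q r : {poly F}) :
    q != 0 -> root (map_poly i q) x -> r != 0 -> root (map_poly i r) y ->
  exists (M : fieldExtType F) (j : {rmorphism M -> Om}),
    [/\ forall a, j a%:A = i a, range j x & range j y].
Proof.
move=> nz_q qx nz_r ry.
have [M1 [j1 [j1E [u _ ju]]]] := simple_fieldExt nz_q qx.
have [||M2 [j2 [j2E M2y]]] :=
  @simple_fieldExt _ _ j1 y (map_poly (in_alg M1) r).
- by rewrite map_poly_eq0.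
- by rewrite -map_poly_comp (eq_map_poly j1E).
exists (baseFieldType M2), j2; split=> // [a|].
  by rewrite baseField_scaleE j2E j1E.
by exists u%:A => //; rewrite j2E.
Qed.

(** * Elements separable over a subfield *)

(** Any separable annihilating polynomial is allowed, not only the minimal one, so that enlarging
    [E] trivially preserves the property. *)
Definition separable_over (Om : fieldType) (E : set Om) (x : Om) : Prop :=
  exists q : {poly Om},
    [/\ forall j, E q`_j, separable_poly q & root q x].

Lemma separable_over_rangeP (F Om : fieldType) (i : {rmorphism F -> Om}) x :
  separable_over (range i) x <->
  exists2 q : {poly F}, separable_poly q & root (map_poly i q) x.
Proof.
split=> [[_ [/poly_coef_range[q ->] sep_q qx]]|[q sep_q qx]].
  by exists q; rewrite // -(separable_map i).
exists (map_poly i q); split=> // [j|]; first by rewrite coef_map; exists q`_j.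
by rewrite separable_map.
Qed.

Section SeparableOver.

Variables (Om : fieldType) (E : set Om).
Hypothesis subE : subfield_set E.

Lemma sub_separable_over (E' : set Om) x :
  E `<=` E' -> separable_over E x -> separable_over E' x.
Proof. by move=> EE' [q [Eq sep_q qx]]; exists q; split=> // j; apply: EE'. Qed.

Lemma separable_over_base : E `<=` separable_over E.
Proof.
move=> x Ex; have [F [i iE]] := subfield_set_range subE.
rewrite iE in Ex *; case: Ex => a _ <-; apply/separable_over_rangeP.
exists ('X - a%:P); last by rewrite map_polyXsubC root_XsubC.
by rewrite unlock derivXsubC coprimep1.
Qed.

Lemma separable_over_subfield : subfield_set (separable_over E).
Proof.
(* Differences and quotients are treated alike: the result of [op] lies in the extension generated
   by two separable elements, which is separable. *)
have closed2 (op : Om -> Om -> Om) :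
    (forall (M : fieldType) (j : {rmorphism M -> Om}) u v,
       exists2 w, op (j u) (j v) = j w &
       forall S : divringClosed M, u \in S -> v \in S -> w \in S) ->
    forall x y, separable_over E x -> separable_over E y ->
    separable_over E (op x y).
  have [F [i iE]] := subfield_set_range subE; rewrite iE.
  move=> opE x y /separable_over_rangeP[q sep_q qx].
  move=> /separable_over_rangeP[r sep_r ry].
  have [M [j [jE [u _ ju] [v _ jv]]]] :=
    double_fieldExt (separable_poly_neq0 sep_q) qx
                    (separable_poly_neq0 sep_r) ry.
  subst x y.
  have sep1 w (t : {poly F}) : separable_poly t ->
      root (map_poly i t) (j w) -> separable_element 1%AS w.
    move=> sep_t tw; apply/separable_elementP; exists (map_poly (in_alg M) t).
    split; first by apply/polyOver1P; exists t.
      by rewrite -(fmorph_root j) -map_poly_comp (eq_map_poly (g := i)).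
    by rewrite separable_map.
  have [w -> wS] := opE M j u v.
  have : separable_element 1%AS w.
    have /separableP : separable 1%AS <<1%AS & [:: u; v]>>.
      by apply: separable_Fadjoin_seq; rewrite /= (sep1 u q) // (sep1 v r).
    by apply; apply: wS; apply: seqv_sub_adjoin; rewrite !inE eqxx ?orbT.
  case/separable_elementP=> _ [/polyOver1P[t ->] tw sep_t].
  apply/separable_over_rangeP; exists t.
    by rewrite -(separable_map (in_alg M)).
  by move: tw; rewrite -(fmorph_root j) -map_poly_comp (eq_map_poly (g := i)).
split; first by apply: separable_over_base; case: subE.
  apply: closed2 => M j u v; exists (u - v); rewrite ?rmorphB // => S.
  exact: rpredB.
apply: closed2 => M j u v; exists (u / v); rewrite ?fmorph_div // => S.
exact: rpred_div.
Qed.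

End SeparableOver.

(** * Frobenius powers and purely inseparable elements *)

Lemma Frobenius_rmorphism (R : comNzRingType) (p k : nat) :
    p \in [pchar R] ->
  exists phi : {rmorphism R -> R}, forall x, phi x = x ^+ (p ^ k).
Proof.
move=> pR; elim: k => [|k [phi phiE]].
  by exists idfun => x; rewrite expr1.
exists (GRing.RMorphism.clone _ _ (pFrobenius_aut pR \o phi) _) => x /=.
by rewrite phiE pFrobenius_autE -exprM expnSr.
Qed.

Lemma exp_pchar_poly (R : comNzRingType) (p k : nat) (phi : {rmorphism R -> R})
    (g : {poly R}) :
    p \in [pchar R] -> (forall x, phi x = x ^+ (p ^ k)) ->
  g ^+ (p ^ k) = map_poly phi g \Po 'X^(p ^ k).
Proof.
move=> pR phiE; have pRX : p \in [pchar {poly R}] by rewrite pchar_poly.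
have [Phi PhiE] := Frobenius_rmorphism k pRX.
rewrite -PhiE; elim/poly_ind: g => [|g c IHg]; first by rewrite !rmorph0.
rewrite !rmorphD !rmorphM /= IHg !PhiE map_polyX map_polyC /= phiE.
by rewrite comp_polyX comp_polyC polyC_exp.
Qed.

(** Over a closed field [d] is a product of distinct linear factors, and each root of [g ^+ k] is a
    root of [g]. *)
Lemma separable_dvdp_exp (F : closedFieldType) (d g : {poly F}) k :
  separable_poly d -> d %| g ^+ k -> d %| g.
Proof.
move=> sep_d d_dv; have [r def_d] := closed_field_poly_normal d.
have nz_lc : lead_coef d != 0 by rewrite lead_coef_eq0 separable_poly_neq0.
have d_eqp : d %= \prod_(z <- r) ('X - z%:P) by rewrite {1}def_d eqp_scale.
rewrite (eqp_dvdl _ d_eqp) uniq_roots_dvdp //; last first.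
  by rewrite uniq_rootsE -separable_prod_XsubC -(eqp_separable d_eqp).
apply/allP=> z rz; have: root (g ^+ k) z.
  rewrite root_factor_theorem (dvdp_trans _ d_dv) // -root_factor_theorem.
  by rewrite (eqp_root d_eqp) root_prod_XsubC.
by rewrite /root horner_exp expf_eq0 => /andP[].
Qed.

(** With [a] the element of [E] equal to [x ^+ (p ^ k)], the polynomial ['X^(p ^ k) - a%:P] becomes
    a power of ['X - x%:P]. Its gcd with a separable polynomial vanishing at [x] is thus ['X - x%:P]
    up to a scalar, and this gcd is defined over [E]. *)
Lemma separable_over_pi (Om : fieldType) (E : set Om) p k x :
    subfield_set E -> p \in [pchar Om] ->
  separable_over E x -> E (x ^+ (p ^ k)) -> E x.
Proof.
move=> subE pOm; have [F [i iE]] := subfield_set_range subE; rewrite iE.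
move=> /separable_over_rangeP[q sep_q qx] [a _ ia].
have [phi phiE] := Frobenius_rmorphism k pOm.
have XqE : map_poly i ('X^(p ^ k) - a%:P) = ('X - x%:P) ^+ (p ^ k).
  rewrite (exp_pchar_poly _ pOm phiE) !map_polyXsubC rmorphB /= map_polyXn.
  by rewrite map_polyC /= ia phiE comp_polyB comp_polyX comp_polyC.
pose d := gcdp q ('X^(p ^ k) - a%:P).
have sep_d : separable_poly (map_poly i d).
  by rewrite separable_map (dvdp_separable _ sep_q) ?dvdp_gcdl.
have dx : root (map_poly i d) x.
  rewrite gcdp_map root_gcd qx XqE /root horner_exp hornerXsubC subrr.
  by rewrite expr0n expn_eq0 eqn0Ngt prime_gt0 ?(pcharf_prime pOm) //= eqxx.
have : map_poly i d %| ('X - x%:P) ^+ (p ^ k).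
  by rewrite -XqE dvdp_map dvdp_gcdr.
case/dvdp_exp_XsubCP=> m _ def_d.
have m_le1 : (m <= 1)%N.
  rewrite leqNgt; apply/negP=> m_gt1.
  have := separable_nosquare (u := 'X - x%:P) sep_d m_gt1.
  by rewrite size_XsubC (eqp_dvdr _ def_d) dvdpp => /(_ isT).
have {m m_le1 def_d} def_d : map_poly i d %= 'X - x%:P.
  case: m m_le1 def_d => [|[|//]] _; last by rewrite expr1.
  by rewrite expr0 => /eqp_root/(_ x); rewrite dx rootC oner_eq0.
have /(congr1 (fun r : {poly Om} => r`_0)) := eqp_eq def_d.
rewrite lead_coefXsubC scale1r lead_coef_map coefZ coef_map coefB coefX coefC.
rewrite !eqxx sub0r => d0.
exists (- (d`_0 / lead_coef d)) => //.
rewrite rmorphN fmorph_div d0 mulrC mulKf ?opprK // fmorph_eq0 lead_coef_eq0.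
by rewrite -(map_poly_eq0 i) separable_poly_neq0.
Qed.


(** * The polynomial [g_i] and its field of coefficients *)

Definition pkroot_poly (K : fieldType) (Kbar : closedFieldType)
    (iota : {rmorphism K -> Kbar}) (p n : nat) (h : {poly K}) : {poly Kbar} :=
  \poly_(j < size h) pkroot p n (iota h`_j).

Section PkrootPoly.

Variables (K : fieldType) (Kbar : closedFieldType).
Variables (iota : {rmorphism K -> Kbar}) (p n : nat) (h : {poly K}).
Hypothesis pKbar : p \in [pchar Kbar].

Local Notation g := (pkroot_poly iota p n h).

Lemma pkroot1 : pkroot p n 1 = 1 :> Kbar.
Proof. by symmetry; apply: pkroot_unique => //; rewrite expr1n. Qed.

Lemma coef_pkroot_poly j : g`_j = pkroot p n (iota h`_j).
Proof.
rewrite coef_poly; have [//|szh] := ltnP j (size h).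
apply: pkroot_unique => //; rewrite nth_default // rmorph0 expr0n expn_eq0.
by rewrite eqn0Ngt prime_gt0 // (pcharf_prime pKbar).
Qed.

Lemma map_pkroot_poly (phi : {rmorphism Kbar -> Kbar}) :
  (forall x, phi x = x ^+ (p ^ n)) -> map_poly phi g = map_poly iota h.
Proof.
move=> phiE; apply/polyP=> j.
by rewrite !coef_map /= coef_pkroot_poly phiE pkrootK.
Qed.

Lemma pkroot_poly_exp : g ^+ (p ^ n) = map_poly iota (h \Po 'X^(p ^ n)).
Proof.
have [phi phiE] := Frobenius_rmorphism n pKbar.
rewrite (exp_pchar_poly _ pKbar phiE) map_pkroot_poly // map_comp_poly.
by rewrite map_polyXn.
Qed.

(** The Frobenius power carries [g] to the image of [h], and field morphisms preserve and reflect
    separability. *)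
Lemma separable_pkroot_poly : separable_poly h -> separable_poly g.
Proof.
have [phi phiE] := Frobenius_rmorphism n pKbar.
by rewrite -(separable_map iota) -(map_pkroot_poly phiE) separable_map.
Qed.

Lemma pkroot_poly_monic : h \is monic -> g \is monic.
Proof.
move=> /monicP h1; have nz_h : h != 0 by rewrite -lead_coef_eq0 h1 oner_neq0.
rewrite monicE lead_coefE; suff -> : size g = size h.
  by rewrite coef_pkroot_poly -lead_coefE h1 rmorph1 pkroot1.
by apply: size_poly_eq; rewrite -lead_coefE h1 rmorph1 pkroot1 oner_neq0.
Qed.

End PkrootPoly.

Lemma monic_comp_polyXn (R : idomainType) (h : {poly R}) k :
  (0 < k)%N -> (h \Po 'X^k \is monic) = (h \is monic).
Proof.
move=> k_gt0; rewrite !monicE lead_coef_comp ?size_polyXn //.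
by rewrite lead_coefXn expr1n mulr1.
Qed.

(* Some [d ^+ (p ^ e)], for [d] the minimal polynomial of [x] over [A], has    *)
(* coefficients in [K], so that [g] and [d] have the same roots; both are      *)
(* separable, hence equal.                                                     *)
Lemma separable_over_pi_coef (K : fieldType) (Om : closedFieldType)
    (iota : {rmorphism K -> Om}) (p k : nat) (A : set Om) (x : Om)
    (f : {poly K}) (g : {poly Om}) :
    p \in [pchar Om] -> subfield_set A -> range iota `<=` A ->
    purely_inseparable_ext iota p A -> separable_over A x ->
    is_minpoly iota x f -> g \is monic -> separable_poly g ->
    g ^+ k = map_poly iota f -> (0 < k)%N ->
  forall j, A g`_j.
Proof.
move=> pOm subA KA piA; have [F [a aE]] := subfield_set_range subA.
rewrite {A subA}aE in KA piA *.
move=> /separable_over_rangeP[m sep_m mx] minf mon_g sep_g gk k_gt0.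
have [d mind] := minpoly_exists (separable_poly_neq0 sep_m) mx.
have sep_d := dvdp_separable (minpoly_dvdp mind mx) sep_m.
(* One exponent serves all coefficients: the largest one works below [size d], and beyond it the
   coefficients are 0. *)
have [e eP] : exists e, forall j, range iota ((a d`_j) ^+ (p ^ e)).
  have /choice[e eP] j : exists e, range iota ((a d`_j) ^+ (p ^ e)).
    by apply: piA; exists d`_j.
  exists (\max_(j < size d) e j) => j; have [jd|dj] := ltnP j (size d).
    have le_e : (e j <= \max_(j < size d) e j)%N.
      exact: (leq_bigmax (Ordinal jd)).
    rewrite -(subnKC le_e) expnD exprM.
    by apply: subfield_setX (eP j); apply: range_subfield.
  rewrite nth_default // rmorph0 expr0n expn_eq0 eqn0Ngt.
  rewrite prime_gt0 ?(pcharf_prime pOm) //=.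
  exact: subfield_set0 (range_subfield iota).
have [phi phiE] := Frobenius_rmorphism e pOm.
have [D DE] : exists D : {poly K},
    map_poly phi (map_poly a d) = map_poly iota D.
  by apply: poly_coef_range => j; rewrite !coef_map /= phiE; apply: eP.
have [_ _ dx] := mind; have [mon_d _ _] := mind; have [_ _ fx] := minf.
(* The power [d ^+ (p ^ e)] is defined over [K] and vanishes at [x], so it is a multiple of [f],
   which is [g ^+ k]. *)
have g_dv : g %| map_poly a d.
  apply: (@separable_dvdp_exp _ _ _ (p ^ e)) => //.
  have: f %| D \Po 'X^(p ^ e).
    apply: minpoly_dvdp minf _.
    rewrite map_comp_poly map_polyXn -DE -(exp_pchar_poly _ pOm phiE).
    rewrite /root horner_exp (rootP dx) expr0n expn_eq0 eqn0Ngt.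
    by rewrite prime_gt0 ?(pcharf_prime pOm) //= eqxx.
  rewrite -(dvdp_map iota) map_comp_poly map_polyXn -DE.
  rewrite -(exp_pchar_poly _ pOm phiE) -gk; apply: dvdp_trans.
  by rewrite -(prednK k_gt0) exprS dvdp_mulr.
have d_dv : map_poly a d %| g.
  apply: (@separable_dvdp_exp _ _ _ k); first by rewrite separable_map.
  have [f' f'E] : exists f' : {poly F}, map_poly iota f = map_poly a f'.
    by apply: poly_coef_range => j; rewrite coef_map; apply: KA; exists f`_j.
  rewrite gk f'E dvdp_map; apply: minpoly_dvdp mind _.
  by rewrite -f'E.
have /eqP -> : g == map_poly a d.
  by rewrite -eqp_monic ?map_monic // /eqp g_dv d_dv.
by move=> j; rewrite coef_map; exists d`_j.
Qed.

(** * Elementwise description of the maximal subextensions *)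

Section MaximalSubextensions.

Variables (K Om : fieldType) (iota : {rmorphism K -> Om}) (L : set Om).
Hypotheses (subL : subfield_set L) (KL : range iota `<=` L).

Let K_sub : subfield_set (range iota) := range_subfield iota.

Lemma maximal_subext_sub P : maximal_subext iota P L `<=` L.
Proof. by apply: subfield_gen_sub => // x [E [[_ _ EL] _]]; apply: EL. Qed.

Lemma sub_maximal_subext P E :
  subextension iota L E -> P E -> E `<=` maximal_subext iota P L.
Proof. by move=> LE PE x Ex; apply: sub_subfield_gen; exists E. Qed.

(** The elements of [L] with a [p]-power in [K] already form a field, as Frobenius respects
    differences and quotients; so the compositum adds nothing. *)
Lemma LpiE p : p \in [pchar Om] ->
  Lpi iota p L = [set x | L x /\ exists k, range iota (x ^+ (p ^ k))].
Proof.
move=> pOm; set E := [set x | _].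
have common (op : Om -> Om -> Om) :
    (forall S : set Om, subfield_set S ->
      forall x y, S x -> S y -> S (op x y)) ->
    (forall k x y, op x y ^+ (p ^ k) = op (x ^+ (p ^ k)) (y ^+ (p ^ k))) ->
    forall x y, E x -> E y -> E (op x y).
  move=> opS opX x y [Lx [k Kx]] [Ly [l Ky]]; split; first exact: opS.
  exists (k + l)%N; rewrite opX; apply: opS => //; rewrite expnD.
    by rewrite exprM; apply: subfield_setX.
  by rewrite mulnC exprM; apply: subfield_setX.
have subE : subfield_set E.
  split; first by split; [case: subL | exists 0; case: K_sub; rewrite expr1n].
    apply: common => [S [] //|k x y].
    by have [phi phiE] := Frobenius_rmorphism k pOm; rewrite -!phiE rmorphB.
  by apply: common => [S [] //|k x y]; rewrite expr_div_n.
apply/seteqP; split; last first.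
  apply: sub_maximal_subext; last by move=> x [].
  split=> // [x Kx|x []//]; split; first exact: KL.
  by exists 0; rewrite expr1.
apply: subfield_gen_sub => // x [M [[_ _ ML] piM] Mx].
by split; [apply: ML | apply: piM].
Qed.

Lemma LsepE : Lsep iota L = [set x | L x /\ separable_over (range iota) x].
Proof.
set E := [set x | _].
have [S1 SB Sdiv] := separable_over_subfield K_sub.
have [L1 LB Ldiv] := subL.
have subE : subfield_set E.
  split=> // x y [Lx Sx] [Ly Sy]; split.
  - exact: LB.
  - exact: SB.
  - exact: Ldiv.
  - exact: Sdiv.
apply/seteqP; split.
  apply: subfield_gen_sub => [|x [M [[_ _ ML] sepM] Mx]].
    exact: subE.
  split; [exact: ML | apply/separable_over_rangeP].
  by have [f [_ _ fx] sep_f] := sepM x Mx; exists f.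
apply: sub_maximal_subext => [|x [_ /separable_over_rangeP[q sep_q qx]]].
  split=> [||x []//].
    exact: subE.
  by move=> x Kx; split; [apply: KL | apply: separable_over_base].
have [f minf] := minpoly_exists (separable_poly_neq0 sep_q) qx; exists f => //.
exact: dvdp_separable (minpoly_dvdp minf qx) sep_q.
Qed.

End MaximalSubextensions.

(** * The equivalence *)

Theorem theorem4p2 (p : nat) (K : fieldType) (charKp : p \in [pchar K])
    (Kbar : closedFieldType) (iota : {rmorphism K -> Kbar})
    (Kbar_alg : forall x : Kbar, algebraicOver iota x)
    (nu : nat) (nu_gt0 : (0 < nu)%N)
    (theta : 'I_nu -> Kbar)
    (f fsep : 'I_nu -> {poly K}) (n s : 'I_nu -> nat)
    (f_min : forall i, is_minpoly iota (theta i) (f i))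
    (fsep_separable : forall i, separable_poly (fsep i))
    (size_fsep : forall i, size (fsep i) = (s i).+1)
    (f_pres : forall i, f i = fsep i \Po 'X^(p ^ n i))
    (L : set Kbar)
    (L_def : L = big_compositum (fun i => adjoin iota [set theta i])) :
  let lambda_root i j := pkroot p (n i) (iota (fsep i)`_j) in
  let K_roots :=
    adjoin iota [set x | exists i j, (j < s i)%N /\ x = lambda_root i j] in
  [<-> L = compositum (Lpi iota p L) (Lsep iota L);
       forall i j, (j < s i)%N -> Lpi iota p L (lambda_root i j);
       Lpi iota p L = K_roots;
       K_roots `<=` Lpi iota p L].
Proof.
move=> lambda_root K_roots.
have pOm : p \in [pchar Kbar] by rewrite (fmorph_pchar iota).
pose g i := pkroot_poly iota p (n i) (fsep i).
have q_gt0 i : (0 < p ^ n i)%N.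
  by rewrite expn_gt0 prime_gt0 ?(pcharf_prime charKp).
have gq i : g i ^+ (p ^ n i) = map_poly iota (f i).
  by rewrite f_pres pkroot_poly_exp.
have sep_g i : separable_poly (g i) by apply: separable_pkroot_poly.
have mon_fsep i : fsep i \is monic.
  by have [+ _ _] := f_min i; rewrite f_pres monic_comp_polyXn.
have mon_g i : g i \is monic by apply: pkroot_poly_monic.
have g_theta i : root (g i) (theta i).
  have [_ _] := f_min i; rewrite -gq /root horner_exp expf_eq0.
  by case/andP.
have sep_theta E i : (forall j, E (g i)`_j) -> separable_over E (theta i).
  by move=> Eg; exists (g i).
(* The roots with [j < s i] suffice: the coefficient of index [s i] is 1, and those beyond are 0. *)
have coef_g E i : subfield_set E ->
    (forall j, (j < s i)%N -> E (lambda_root i j)) ->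
    forall j, E (g i)`_j.
  move=> subE Eroots j; rewrite coef_pkroot_poly //.
  have [/Eroots//|le_sj] := ltnP j (s i).
  have [->|ne_js] := eqVneq j (s i).
    have := monicP (mon_fsep i); rewrite lead_coefE size_fsep /= => ->.
    by rewrite rmorph1 pkroot1 //; case: subE.
  have -> : pkroot p (n i) (iota (fsep i)`_j) = (g i)`_j.
    by rewrite coef_pkroot_poly.
  rewrite nth_default; first exact: subfield_set0.
  rewrite (leq_trans (size_poly _ _)) // size_fsep ltn_neqAle eq_sym ne_js //.
have subL : subfield_set L by rewrite L_def; apply: subfield_gen_subfield.
have KL : range iota `<=` L.
  rewrite L_def => x Kx; apply: sub_subfield_gen; exists (Ordinal nu_gt0) => //.
  by apply: sub_subfield_gen; left.
have L_theta i : L (theta i).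
  rewrite L_def; apply: sub_subfield_gen; exists i => //.
  by apply: sub_subfield_gen; right.
have L_sub E : subfield_set E -> range iota `<=` E -> (forall i, E (theta i)) ->
    L `<=` E.
  move=> subE KE Etheta; rewrite L_def; apply: subfield_gen_sub => // x [i _].
  by apply: subfield_gen_sub x => // x [/KE//|->].
have subLpi : subfield_set (Lpi iota p L) by apply: subfield_gen_subfield.
have piLpi : purely_inseparable_ext iota p (Lpi iota p L).
  by rewrite LpiE // => x [].
have KLpi : range iota `<=` Lpi iota p L.
  rewrite LpiE // => x Kx; split; first exact: KL.
  by exists 0; rewrite expr1.
have subKr : subfield_set K_roots by apply: subfield_gen_subfield.
have KKr : range iota `<=` K_roots.
  by move=> x Kx; apply: sub_subfield_gen; left.
have Kr_lambda i j : (j < s i)%N -> K_roots (lambda_root i j).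
  by move=> ji; apply: sub_subfield_gen; right; exists i, j.
have Kr_sep_theta i : separable_over K_roots (theta i).
  by apply: sep_theta; apply: coef_g => // j; apply: Kr_lambda.
tfae.
(* From 1 to 2: [Lpi] and [Lsep] both consist of elements separable over [Lpi], hence so does [L],
   which contains [theta i]. *)
- move=> defL i j _; rewrite /lambda_root -coef_pkroot_poly //.
  apply: (separable_over_pi_coef pOm subLpi KLpi piLpi _ (f_min i) _ _ (gq i))
    => //.
  have := L_theta i; rewrite {1}defL; apply: subfield_gen_sub => [|x].
    exact: separable_over_subfield.
  case; first exact: separable_over_base.
  rewrite LsepE // => -[_]; exact: sub_separable_over.
- move=> Lpi_lambda; apply/seteqP; split.
    (* All of [L] is separable over [K_roots], since each [theta i] is; and [x] has a [p]-power in
       [K]. *)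
    move=> x; rewrite LpiE // => -[Lx [k /KKr Kx]].
    apply: separable_over_pi Kx => //.
    apply: L_sub Lx => //; first exact: separable_over_subfield.
    by move=> y /KKr; apply: separable_over_base.
  apply: subfield_gen_sub => // x [/KLpi//|[i [j [ji ->]]]]; exact: Lpi_lambda.
- by move->.
- move=> KrLpi; set M := compositum _ _.
  have subM : subfield_set M by apply: subfield_gen_subfield.
  have LpiM : Lpi iota p L `<=` M by move=> x ?; apply: sub_subfield_gen; left.
  have LsepM : Lsep iota L `<=` M by move=> x ?; apply: sub_subfield_gen; right.
  apply/seteqP; split; last first.
    by apply: subfield_gen_sub => // x []; apply: maximal_subext_sub.
  apply: (L_sub M subM) => [x /KLpi/LpiM//|i].
  apply: (@separable_over_pi _ M p (n i) (theta i)) => //.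
    by apply: sub_separable_over (Kr_sep_theta i) => x /KrLpi/LpiM.
  (* The power of [theta i] is a root of the separable polynomial [fsep i]. *)
  apply: LsepM; rewrite LsepE //; split; first exact: subfield_setX.
  apply/separable_over_rangeP; exists (fsep i) => //.
  have [_ _] := f_min i.
  by rewrite f_pres map_comp_poly map_polyXn /root horner_comp hornerXn.
Qed.
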